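(* Let $n\ge 2$ and $q\ge 1$ be integers, and let $A\in\mathbb{R}^{n\times n}$, $B\in\mathbb{R}^{n\times 1}$ (single input, $m=1$), $C\in\mathbb{R}^{q\times n}$. Then for every $K\in\mathbb{R}^{1\times n}$, $$\det\left(\mathcal{C}_{(A,B,C)}\right)=\det\left(\mathcal{C}_{(A-BK,B,C)}\right),$$ where $\mathcal{C}_{(A,B,C)}$ and $\mathcal{C}_{(A-BK,B,C)}$ are the $n\times n$ controllability matrices of the triples $(A,B,C)$ and $(A-BK,B,C)$, respectively.
   Context: The triple $(A,B,C)$ represents the linear time-invariant control system $\dot x(t)=Ax(t)+Bu(t)$, $y(t)=Cx(t)$, with state $x(t)\in\mathbb{R}^n$ and control $u(t)\in\mathbb{R}^m$; here $m=1$. With the state feedback $u(t)=-Kx(t)+r(t)$, where $K$ is an $m\times n$ gain matrix and $r(t)$ an external input, the closed loop system is $\dot x(t)=(A-BK)x(t)+Br(t)$. For a triple $(A,B,C)$ with $A$ of size $n\times n$ and $B$ of size $n\times m$, the controllability matrix is the $n\times nm$ block matrix $$\mathcal{C}_{(A,B,C)}=\left[\,B\ \ AB\ \ A^2B\ \ \cdots\ \ A^{n-1}B\,\right]$$ (it does not depend on $C$). Thus $$\mathcal{C}_{(A-BK,B,C)}=\left[\,B\ \ (A-BK)B\ \ (A-BK)^2B\ \ \cdots\ \ (A-BK)^{n-1}B\,\right].$$ For $m=1$ both matrices are square of size $n\times n$. *)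

(* Defs.v *)
From mathcomp Require Import all_boot all_order all_algebra.
From mathcomp Require Import reals.

Set Implicit Arguments.
Unset Strict Implicit.
Unset Printing Implicit Defensive.

Import GRing.Theory.
Local Open Scope ring_scope.

(* x' = A x + B u, y = C x, with n states, m inputs and q outputs *)
Record lti_system (R : realType) (n m q : nat) := LTI {
  state_mx : 'M[R]_n;
  input_mx : 'M[R]_(n, m);
  output_mx : 'M[R]_(q, n)
}.

Lemma ctrb_width (n m : nat) : (\sum_(j < n) m)%N = (n * m)%N.
Proof. by rewrite sum_nat_const card_ord. Qed.

(* The cast only renames the width of the block row [B, AB, ..., A^(n-1) B]
   from \sum_(j < n) m to n * m. *)
Definition controllability_mx (R : realType) (n m q : nat)
    (S : lti_system R n m q) : 'M[R]_(n, n * m) :=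
  castmx (erefl n, ctrb_width n m)
    (\mxrow_(j < n) (state_mx S ^+ j *m input_mx S)).

(* For a single input, n * 1 is only propositionally equal to n, so a cast is
   needed for the controllability matrix to have a determinant. *)
Definition controllability_mx1 (R : realType) (n q : nat)
    (S : lti_system R n 1 q) : 'M[R]_n :=
  castmx (erefl n, muln1 n) (controllability_mx S).

(* Main.v *)
Require Import Defs.
From mathcomp Require Import all_boot all_order all_algebra.
From mathcomp Require Import reals.

Import GRing.Theory.
Local Open Scope ring_scope.

(** Feeding back [- K x] alters the state only along the columns of [B].  Write
    [F = A - B *m K].  With a single input, [K *m F ^+ j *m B] is a scalar, so
    [F ^+ j.+1 *m B = A *m (F ^+ j *m B) - (K *m F ^+ j *m B) 0 0 *: B].
    By induction, column [j] of the closed loop controllability matrix is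
    column [j] of the open loop one plus a linear combination of the columns
    before it ([feedback_expansion]).  The two matrices therefore differ by a
    unitriangular right factor, and have the same determinant
    ([det_unitriangular_columns]). *)

(** The matrix of the [v j] is that of the [u j] times the upper triangular
    matrix of the [c i j], whose determinant is the product of the [c j j]. *)
Lemma det_unitriangular_columns (R : comNzRingType) (n : nat)
    (u v : nat -> 'cV[R]_n) (c : nat -> nat -> R) :
  (forall j, c j j = 1) ->
  (forall j, v j = \sum_(i < j.+1) c i j *: u i) ->
  \det (\matrix_(i, j < n) v j i 0) = \det (\matrix_(i, j < n) u j i 0).
Proof.
move=> c1 vE; pose T : 'M[R]_n := \matrix_(i, j) if (i <= j)%N then c i j else 0.
have -> : \matrix_(i, j < n) v j i 0 = (\matrix_(i, j < n) u j i 0) *m T.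
  apply/matrixP => r j; rewrite !mxE vE summxE.
  rewrite (big_ord_widen n (fun i => (c i j *: u i) r 0)) // big_mkcond /=.
  apply: eq_bigr => i _; rewrite !mxE ltnS.
  by case: ifP; rewrite ?mulr0 // mulrC.
rewrite det_mulmx -(det_tr T) [\det T^T]det_trig.
  by rewrite big1 ?mulr1 // => i _; rewrite !mxE leqnn c1.
by apply/is_trig_mxP => i j lt_ij; rewrite !mxE leqNgt lt_ij.
Qed.

(** The coefficient of [A ^+ i *m B] in [(A - B *m K) ^+ j *m B] depends only on
    [k = j - i]: one more step shifts every power of [A] by one and adds a new
    multiple of [B]. *)
Definition feedback_coef {R : comNzRingType} {n : nat}
    (A : 'M[R]_n) (B : 'cV[R]_n) (K : 'rV[R]_n) (k : nat) : R :=
  if k is k'.+1 then - (K *m ((A - B *m K) ^+ k' *m B)) 0 0 else 1.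

Lemma feedback_expansion (R : comNzRingType) (n : nat)
    (A : 'M[R]_n) (B : 'cV[R]_n) (K : 'rV[R]_n) (j : nat) :
  (A - B *m K) ^+ j *m B =
    \sum_(i < j.+1) feedback_coef A B K (j - i) *: (A ^+ i *m B).
Proof.
elim: j => [|j IHj]; first by rewrite big_ord1 scale1r.
(* The term [i = 0] is the new multiple of [B] coming from the feedback; the
   others are the expansion of [(A - B *m K) ^+ j *m B] multiplied by [A]. *)
rewrite exprS -mulmxA mulmxBl big_ord_recl expr0 mul1mx addrC; congr (_ + _).
  rewrite -[B *m K *m _]mulmxA [X in B *m X]mx11_scalar mul_mx_scalar.
  by rewrite -scaleNr.
rewrite [in LHS]IHj mulmx_sumr; apply: eq_bigr => i _.
by rewrite -scalemxAr mulmxA /= subSS exprS.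
Qed.

(** With one input every block has width 1, so the rank of a column in the block
    row is the index of its block, and the two casts preserve that rank. *)
Lemma controllability_mx1E (R : realType) (n q : nat) (S : lti_system R n 1 q) :
  controllability_mx1 S =
    \matrix_(i, j < n) (state_mx S ^+ j *m input_mx S) i 0.
Proof.
apply/matrixP => i j.
rewrite [RHS]mxE /controllability_mx1 /controllability_mx !castmxE !mxE /=.
rewrite !cast_ord_id.
(* By [tagnat.rect], the rank [s] is the total width of the blocks before that
   of [s], which is their number, plus the offset of [s] in its block, which
   is 0. *)
set s := cast_ord _ _; have sE : s = j :> nat by [].
have s1E : tagnat.sig1 s = j :> nat.
  rewrite -[RHS]sE [RHS]tagnat.rect ord1 addn0.
  rewrite -(big_ord_widen n (fun=> 1%N)) ?sum1_card ?card_ord //.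
  exact/ltnW/ltn_ord.
by rewrite s1E [tagnat.sig2 s]ord1.
Qed.

Theorem theorem5 (R : realType) (n q : nat) (hn : (2 <= n)%N) (hq : (1 <= q)%N)
    (A : 'M[R]_n) (B : 'M[R]_(n, 1)) (C : 'M[R]_(q, n)) (K : 'M[R]_(1, n)) :
  \det (controllability_mx1 (LTI A B C)) =
  \det (controllability_mx1 (LTI (A - B *m K) B C)).
Proof.
rewrite !controllability_mx1E /=; symmetry.
apply: (det_unitriangular_columns _ _ (fun j => A ^+ j *m B)
  (fun j => (A - B *m K) ^+ j *m B) (fun i j => feedback_coef A B K (j - i))).
  by move=> j; rewrite subnn.
by move=> j; apply: feedback_expansion.
Qed.
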